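(* Let $n$ be a positive integer and let $m\neq 0$ and $r$ be coprime integers. The polynomial $S_{m,r}^n(\ell)$ in the variable $\ell$ has integer coefficients if and only if $F(n)\mid m$.
   Context: For coprime integers $m\neq 0$ and $r$, and a positive integer $n$, $S_{m,r}^n(\ell)$ denotes the polynomial in $\ell$ (with rational coefficients) whose value at every positive integer $\ell$ is \[S_{m,r}^n(\ell)=r^n+(m+r)^n+(2m+r)^n+\cdots+((\ell-1)m+r)^n .\] Explicitly, $S_{m,r}^n(\ell)=\frac{m^n}{n+1}\left(B_{n+1}\left(\ell+\frac{r}{m}\right)-B_{n+1}\left(\frac{r}{m}\right)\right)$, where the Bernoulli polynomials $B_k(x)$ are defined by $\frac{te^{tx}}{e^t-1}=\sum_{k=0}^\infty B_k(x)\frac{t^k}{k!}$, and $B_k=B_k(0)$ is the $k$th Bernoulli number. The denominator of a rational number $q$ is the smallest positive integer $d$ such that $dq$ is an integer. $\Lambda_j$ denotes the denominator of the Bernoulli number $B_j$. For a positive integer $N$, $\mathrm{rad}(N)=\prod_{p\mid N,\ p\text{ prime}}p$. For an even number $j$ with $2\le j\le n$ put \[f(n,j):=\mathrm{lcm}\left(\frac{\Lambda_j}{\gcd\left(\Lambda_j,\binom{n+1}{j}\binom{j}{j}\right)},\ \frac{\Lambda_j}{\gcd\left(\Lambda_j,\binom{n+1}{j+1}\binom{j+1}{j}\right)},\ \ldots,\ \frac{\Lambda_j}{\gcd\left(\Lambda_j,\binom{n+1}{n}\binom{n}{j}\right)}\right),\] that is, the least common multiple over all integers $k$ with $j\le k\le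 n$ of $\Lambda_j/\gcd\left(\Lambda_j,\binom{n+1}{k}\binom{k}{j}\right)$. Further define \[F(n):=\begin{cases}\mathrm{lcm}\left(\mathrm{rad}(n+1),f(n,2),f(n,4),\ldots,f(n,n)\right)&\text{if } n \text{ is even},\\ \mathrm{lcm}\left(\mathrm{rad}(n+1),f(n,2),f(n,4),\ldots,f(n,n-1)\right)&\text{if } n\text{ is odd},\end{cases}\] i.e. the least common multiple of $\mathrm{rad}(n+1)$ and all $f(n,j)$ with $j$ even, $2\le j\le n$ (so $F(1)=\mathrm{rad}(2)=2$). *)

(* Defs.v *)
From mathcomp Require Import all_boot all_order all_algebra.
From mathcomp Require Import ring lra zify.

Set Implicit Arguments.
Unset Strict Implicit.
Unset Printing Implicit Defensive.

Import Order.TTheory GRing.Theory Num.Theory.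
Local Open Scope ring_scope.

(* A formal power series in t is represented by its coefficient sequence
   [nat -> R]. *)

Definition fps_mul (R : comNzRingType) (a b : nat -> R) (n : nat) : R :=
  \sum_(i < n.+1) a i * b (n - i)%N.

(* The first n coefficients of the inverse of a, whose constant term must be a
   unit. *)
Fixpoint fps_inv_seq (R : fieldType) (a : nat -> R) (n : nat) : seq R :=
  if n is k.+1 then
    let s := fps_inv_seq a k in
    rcons s ((a 0%N)^-1 * ((k == 0%N)%:R - \sum_(i < k) s`_i * a (k - i)%N))
  else [::].

Definition fps_inv (R : fieldType) (a : nat -> R) (n : nat) : R :=
  (fps_inv_seq a n.+1)`_n.

(* t / (e^t - 1), as the inverse of (e^t - 1) / t = \sum_k t^k / (k+1)!;
   see [fps_mulV]. *)
Definition t_div_expm1 : nat -> rat := fps_inv (fun k => (k.+1)`!%:R^-1).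

(* B_k(x) is k! times the coefficient of t^k in e^(t x) * (t / (e^t - 1)). *)
Definition bernoulli_poly (k : nat) : {poly rat} :=
  k`!%:R *: fps_mul (fun i => i`!%:R^-1 *: 'X^i)
                    (fun i => (t_div_expm1 i)%:P) k.

Definition bernoulli (k : nat) : rat := (bernoulli_poly k).[0].

(* The polynomial in l equal to r^n + (m+r)^n + ... + ((l-1)m+r)^n at every
   positive integer l; see [power_sumP] below. *)
Definition power_sum (m r : int) (n : nat) : {poly rat} :=
  let q : rat := r%:~R / m%:~R in
  (m%:~R ^+ n / n.+1%:R) *:
    (bernoulli_poly n.+1 \Po ('X + q%:P) - (bernoulli_poly n.+1).[q]%:P).

Definition Lambda (j : nat) : nat := `|denq (bernoulli j)|%N.

Definition rad (N : nat) : nat := (\prod_(p <- primes N) p)%N.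

Definition f (n j : nat) : nat :=
  \big[lcmn/1%N]_(j <= k < n.+1)
    (Lambda j %/ gcdn (Lambda j) ('C(n.+1, k) * 'C(k, j)))%N.

Definition F (n : nat) : nat :=
  lcmn (rad n.+1) (\big[lcmn/1%N]_(2 <= j < n.+1 | ~~ odd j) f n j).

Lemma size_fps_inv_seq (R : fieldType) (a : nat -> R) n :
  size (fps_inv_seq a n) = n.
Proof. by elim: n => //= n IH; rewrite size_rcons IH. Qed.

Lemma nth_fps_inv_seq (R : fieldType) (a : nat -> R) n i : (i < n)%N ->
  (fps_inv_seq a n)`_i = fps_inv a i.
Proof.
elim: n => // n IH; rewrite ltnS leq_eqVlt => /orP[/eqP -> //|lin].
by rewrite /= nth_rcons size_fps_inv_seq lin IH.
Qed.

Lemma fps_mulV (R : fieldType) (a : nat -> R) n : a 0%N != 0 ->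
  fps_mul (fps_inv a) a n = (n == 0%N)%:R.
Proof.
move=> a0; rewrite /fps_mul big_ord_recr /= subnn {2}/fps_inv /=.
rewrite nth_rcons size_fps_inv_seq ltnn eqxx mulrC mulrA mulfV // mul1r.
under [X in _ + (_ - X)]eq_bigr => i _ do rewrite nth_fps_inv_seq //.
by rewrite addrC subrK.
Qed.

Lemma fps_mulE (R : comNzRingType) (a b : nat -> R) N n : (n < N)%N ->
  fps_mul a b n = (\poly_(i < N) a i * \poly_(i < N) b i)`_n.
Proof.
move=> nN; rewrite coefM; apply: eq_bigr => i _; rewrite !coef_poly.
have -> : (i < N)%N by have := ltn_ord i; lia.
by have -> : (n - i < N)%N by lia.
Qed.

Lemma fps_mulC (R : comNzRingType) (a b : nat -> R) n :
  fps_mul a b n = fps_mul b a n.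
Proof. by rewrite !(@fps_mulE _ _ _ n.+1) // mulrC. Qed.

Lemma eq_fps_mul (R : comNzRingType) (a a' b b' : nat -> R) n :
  a =1 a' -> b =1 b' -> fps_mul a b n = fps_mul a' b' n.
Proof. by move=> ea eb; apply: eq_bigr => i _; rewrite ea eb. Qed.

Lemma fps_mulA (R : comNzRingType) (a b c : nat -> R) n :
  fps_mul a (fps_mul b c) n = fps_mul (fps_mul a b) c n.
Proof.
pose T (u : nat -> R) := \poly_(i < n.+1) u i.
have TE u i : (i <= n)%N -> (T u)`_i = u i by move=> ?; rewrite coef_poly ltnS ifT.
have tl u v w : fps_mul (fps_mul u v) w n = (T u * T v * T w)`_n.
  rewrite coefM; apply: eq_bigr => i _.
  by rewrite (@fps_mulE _ _ _ n.+1) ?ltn_ord // TE ?leq_subr.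
by rewrite fps_mulC !tl mulrC mulrA.
Qed.

Lemma fps_mul_shift (R : comNzRingType) (a b : nat -> R) n :
  fps_mul (fun k => if k is i.+1 then a i else 0) b n =
  if n is k.+1 then fps_mul a b k else 0.
Proof.
case: n => [|n]; rewrite /fps_mul big_ord_recl mul0r add0r ?big_ord0 //.
Qed.

Lemma fps_mul1 (R : comNzRingType) (a : nat -> R) n :
  fps_mul a (fun k => (k == 0%N)%:R) n = a n.
Proof.
rewrite /fps_mul big_ord_recr /= subnn mulr1 big1 ?add0r // => i _.
by rewrite subn_eq0 leqNgt ltn_ord mulr0.
Qed.

Lemma fact_neq0 k : (k`!%:R : rat) != 0.
Proof. by rewrite pnatr_eq0 -lt0n fact_gt0. Qed.

(* (e^t - 1) * \sum_k B_k(x) t^k / k! = t e^(t x) *)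
Lemma bernoulli_poly_gf n :
  fps_mul (fun k => if k is i.+1 then (i.+1`!%:R^-1)%:P else 0)
          (fun k => k`!%:R^-1 *: bernoulli_poly k) n =
  if n is k.+1 then k`!%:R^-1 *: 'X^k else 0.
Proof.
rewrite (fps_mul_shift (fun i => (i.+1`!%:R^-1)%:P)).
case: n => // n.
pose e i : {poly rat} := i`!%:R^-1 *: 'X^i.
pose a i : {poly rat} := (i.+1`!%:R^-1)%:P.
pose c i := (t_div_expm1 i)%:P.
rewrite (@eq_fps_mul _ _ a _ (fps_mul e c)) => [||k]; last 2 first.
- by [].
- by rewrite /bernoulli_poly scalerA mulVf ?fact_neq0 // scale1r.
rewrite fps_mulC -fps_mulA -[RHS](fps_mul1 e); apply: eq_fps_mul => // k.
transitivity ((fps_mul t_div_expm1 (fun i => i.+1`!%:R^-1) k)%:P).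
  by rewrite /fps_mul rmorph_sum; apply: eq_bigr => i _; rewrite /= polyCM.
by rewrite fps_mulV ?fact_neq0 // polyC_natr.
Qed.

Lemma horner_bernoulli_poly n x :
  (bernoulli_poly n).[x] =
  n`!%:R * fps_mul (fun i => x ^+ i / i`!%:R) t_div_expm1 n.
Proof.
rewrite hornerZ /fps_mul horner_sum; congr (_ * _); apply: eq_bigr => i _.
by rewrite hornerM hornerC hornerZ hornerXn [_^-1 * _]mulrC.
Qed.

Lemma bernoulli_poly_diff n x :
  (bernoulli_poly n.+1).[x + 1] - (bernoulli_poly n.+1).[x] = n.+1%:R * x ^+ n.
Proof.
pose e i : rat := x ^+ i / i`!%:R.
pose a i : rat := i.+1`!%:R^-1.
have eD k : (x + 1) ^+ k / k`!%:R - e k =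
    fps_mul (fun k => if k is i.+1 then a i else 0) e k.
  rewrite fps_mulC /fps_mul big_ord_recr /= subnn mulr0 addr0 exprDn mulr_suml.
  rewrite (reindex_inj rev_ord_inj) big_ord_recr /= subnn subn0 expr0 bin0.
  rewrite mulr1n mulr1 addrK.
  apply: eq_bigr => i _; rewrite subSS subKn 1?ltnW // expr1n mulr1.
  have -> : 'C(k, k - i) = 'C(k, i) by rewrite bin_sub // ltnW.
  have := ltnW (ltn_ord i); rewrite /e /a => lik.
  have [j kiE] : exists j, (k - i = j.+1)%N.
    by exists (k - i).-1; have := ltn_ord i; lia.
  rewrite -(bin_fact lik) kiE.
  have := fact_neq0 i; have := fact_neq0 j.+1.
  have : ('C(k, i)%:R : rat) != 0 by rewrite pnatr_eq0 -lt0n bin_gt0.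
  move: (j.+1)`! i`! 'C(k, i) => u v w w0 u0 v0.
  by rewrite !natrM -mulr_natr; field; rewrite u0 v0 w0.
rewrite !horner_bernoulli_poly -mulrBr.
have -> : fps_mul (fun i => (x + 1) ^+ i / i`!%:R) t_div_expm1 n.+1 -
    fps_mul e t_div_expm1 n.+1 =
    fps_mul (fps_mul (fun k => if k is i.+1 then a i else 0) e) t_div_expm1 n.+1.
  rewrite /fps_mul -sumrB; apply: eq_bigr => i _.
  by rewrite -mulrBl eD.
rewrite -fps_mulA (fps_mul_shift a) fps_mulC -fps_mulA.
rewrite (@eq_fps_mul _ _ e _ (fun k => (k == 0%N)%:R)) => [||k]; last 2 first.
- by [].
- by rewrite fps_mulV ?fact_neq0.
by rewrite fps_mul1 /e factS natrM; field; rewrite fact_neq0.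
Qed.

Lemma horner_power_sum (m r : int) n l : m != 0 ->
  (power_sum m r n).[l%:R] = \sum_(i < l) (i%:R * m%:~R + r%:~R) ^+ n.
Proof.
move=> m0; have mq : (m%:~R : rat) != 0 by rewrite intr_eq0.
rewrite hornerZ hornerD hornerN hornerC horner_comp hornerD hornerX hornerC.
set q := r%:~R / m%:~R.
elim: l => [|l IH]; first by rewrite big_ord0 add0r subrr mulr0.
rewrite big_ord_recr /= -IH -[l.+1%:R]natr1 [_ + 1 + q]addrAC.
have := bernoulli_poly_diff n (l%:R + q); move/eqP; rewrite subr_eq => /eqP ->.
have -> : l%:R * m%:~R + r%:~R = m%:~R * (l%:R + q) by rewrite /q; field.
have n0 : (n.+1%:R : rat) != 0 by rewrite pnatr_eq0.
by rewrite exprMn; move: n.+1%:R n0 => N N0; field.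
Qed.

(* [power_sum m r n] is the unique polynomial with the prescribed values. *)
Lemma power_sumP (m r : int) n (S : {poly rat}) : m != 0 ->
  S = power_sum m r n <->
  (forall l, (0 < l)%N ->
     S.[l%:R] = \sum_(i < l) (i%:R * m%:~R + r%:~R) ^+ n).
Proof.
move=> m0; split=> [-> l _|H]; first exact: horner_power_sum.
apply/eqP; rewrite -subr_eq0; apply: contraT => D0.
pose rs := [seq (i.+1)%:R : rat | i <- iota 0 (size (S - power_sum m r n))].
have : (size rs < size (S - power_sum m r n)%R)%N.
  apply: max_poly_roots => //; last first.
    by rewrite map_inj_uniq ?iota_uniq // => i j /eqP; rewrite eqr_nat => /eqP [].
  apply/allP=> _ /mapP[i _ ->].
  by rewrite rootE hornerD hornerN H // horner_power_sum // subrr.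
by rewrite size_map size_iota ltnn.
Qed.

(* Main.v *)
From HB Require Import structures.
Require Import Defs.
From mathcomp Require Import all_boot all_order all_algebra.
From mathcomp Require Import ring lra zify.
Import Order.TTheory GRing.Theory Num.Theory.
Local Open Scope ring_scope.

(** Everything is decided one prime p at a time, in the subring Z_(p) of Q
    ([loc_int p^'] below): a polynomial has integer coefficients iff its
    coefficients lie in Z_(p) for every p.

    Put P = S_{1,0}^n = (B_{n+1}(X) - B_{n+1}) / (n+1) ([faulhaber n]) and
    q = r/m. Then S_{m,r}^n = m^n (P(X + q) - P(q)) ([power_sumE]).

    - If p divides m, then S_{m,r}^n always has coefficients in Z_(p)
      ([power_sum_loc_int]). The powers of m absorb all the denominators:
      p B_k lies in Z_(p) ([bernoulli_loc_int], the easy half of the theorem of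
      von Staudt and Clausen), hence so does m^k B_k, and m^s / (s+1) lies in
      Z_(p) because p^s >= s+1.

    - If p does not divide m, then m is a unit of Z_(p) and q lies in Z_(p), so
      that the translation X -> X + q is invertible over Z_(p); hence
      S_{m,r}^n has coefficients in Z_(p) iff P does
      ([polyOver_power_sum_unit]). The coefficients of P are
      C(n+1,j) B_j / (n+1) for 0 <= j <= n. The one for j = 0 is 1/(n+1), which
      forces p not to divide n+1; those for odd j > 1 vanish; and the one for
      j = 1 follows from the others, since P(1) = 0. So the condition is that
      p does not divide n+1 and that C(n+1,j) B_j lies in Z_(p) for all even j
      in [2, n] ([polyOver_faulhaber]).

    On the other side, the lcm defining f(n,j) collapses to its term k = j,
    because C(n+1,j) divides C(n+1,k) C(k,j). Therefore F(n) | m iff every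
    prime factor of n+1 divides m and m C(n+1,j) B_j is an integer for all even
    j in [2, n] ([dvdn_F]). Read prime by prime, this is the same condition:
    at p | m it holds automatically, as p B_j is in Z_(p), and at the other
    primes m can be cancelled. *)

(** * Localizations of the integers *)

Lemma mulr_nat_int (x : rat) (d : nat) :
  (x * d%:R \is a Num.int) = (`|denq x| %| d)%N.
Proof.
apply/idP/idP => [/intrP[z xdz]|/dvdnP[k ->]]; last first.
  have -> : x * (k * `|denq x|)%:R = (numq x)%:~R * k%:R.
    by rewrite numqE natrM -[in RHS]absz_denq -pmulrn; ring.
  by rewrite rpredM ?rpred_int ?rpred_nat.
have eqz : numq x * d%:Z = z * denq x.
  apply: (@intr_inj rat); rewrite !intrM -xdz numqE.
  by rewrite mulrAC.
have : (denq x %| numq x * d%:Z)%Z by rewrite eqz dvdz_mull.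
rewrite Gauss_dvdzr ?dvdzE //.
by rewrite coprimezE coprime_sym coprime_num_den.
Qed.

(** The ring of fractions with denominator a pi-number; Z_(p) is the case
    pi = p^', the set of the primes other than p. Being a pi-number is
    stable under products and divisors for any pi, so that the ring structure
    below does not depend on a primality proof. *)
Definition loc_int (pi : nat_pred) : {pred rat} :=
  fun x => pi.-nat `|denq x|%N.

Lemma loc_intP pi x :
  reflect (exists2 d, pi.-nat d & x * d%:R \is a Num.int) (x \in loc_int pi).
Proof.
apply: (iffP idP) => [xP|[d piD]]; first by exists `|denq x|%N; rewrite ?mulr_nat_int.
by rewrite mulr_nat_int => /pnat_dvd; apply.
Qed.

Lemma loc_int_int pi : {subset Num.int <= loc_int pi}.
Proof. by move=> x xZ; apply/loc_intP; exists 1%N => //; rewrite mulr1. Qed.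

Fact loc_int_subring pi : subring_closed (loc_int pi).
Proof.
split=> [|x y /loc_intP[d dP xd] /loc_intP[e eP ye]
         |x y /loc_intP[d dP xd] /loc_intP[e eP ye]].
- by apply: loc_int_int; apply: rpred1.
- apply/loc_intP; exists (d * e)%N; first by rewrite pnatM dP.
  rewrite (_ : (x - y) * _ = (x * d%:R) * e%:R - (y * e%:R) * d%:R);
    last by rewrite natrM; ring.
  by apply: rpredB; apply: rpredM => //; apply: rpred_nat.
- apply/loc_intP; exists (d * e)%N; first by rewrite pnatM dP.
  rewrite (_ : x * y * _ = (x * d%:R) * (y * e%:R));
    last by rewrite natrM; ring.
  by rewrite rpredM.
Qed.

HB.instance Definition _ pi :=
  GRing.isSubringClosed.Build rat (loc_int pi) (loc_int_subring pi).

Lemma loc_intV pi d : pi.-nat d -> (d%:R^-1 : rat) \in loc_int pi.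
Proof.
move=> piD; apply/loc_intP; exists d => //; rewrite mulVf ?rpred1 //.
by rewrite pnatr_eq0 -lt0n; case/andP: piD.
Qed.

Lemma int_localP (x : rat) :
  x \is a Num.int <-> (forall p, prime p -> x \in loc_int p^').
Proof.
split=> [xZ p _|xP]; first exact: loc_int_int.
rewrite -[x]mulr1 (mulr_nat_int x 1) dvdn1; apply: contraT => dx1.
have dx0 : (0 < `|denq x|)%N by rewrite absz_gt0 denq_neq0.
have p_pr : prime (pdiv `|denq x|) by rewrite pdiv_prime // ltn_neqAle eq_sym dx1.
by have := xP _ p_pr; rewrite unfold_in p'natE // pdiv_dvd.
Qed.

Lemma polyOver_int_localP (P : {poly rat}) :
  P \is a polyOver Num.int <->
  (forall p, prime p -> P \is a polyOver (loc_int p^')).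
Proof.
split=> [/polyOverP PZ p _|PP]; first by apply/polyOverP => i; apply: loc_int_int.
by apply/polyOverP => i; apply/int_localP => p /PP /polyOverP.
Qed.

(** The p-part of s+1 divides p^s, because its exponent is at most s. *)
Lemma expr_div_loc_int p (m : int) s : prime p -> (p%:Z %| m)%Z ->
  m%:~R ^+ s / s.+1%:R \in loc_int p^'.
Proof.
move=> p_pr /dvdzP[k ->]; rewrite intrM exprMn -mulrA rpredM //.
  by rewrite rpredX // loc_int_int ?rpred_int.
have /dvdnP[c cE] : (s.+1`_p %| p ^ s)%N.
  by rewrite p_part dvdn_exp2l // -ltnS ltn_logl.
have -> : p%:~R ^+ s / s.+1%:R = c%:R * (s.+1`_p^')%N%:R^-1 :> rat.
  rewrite -[in LHS](partnC p (ltn0Sn s)) -[p%:~R]/(p%:R) -natrX cE !natrM.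
  have : ((s.+1`_p)%N%:R : rat) != 0 by rewrite pnatr_eq0 -lt0n part_gt0.
  have : ((s.+1`_p^')%N%:R : rat) != 0 by rewrite pnatr_eq0 -lt0n part_gt0.
  by move: (_%:R) (_%:R) => a b a0 b0; field; rewrite a0 b0.
by apply: rpredM; [apply: rpred_nat | apply/loc_intV/part_pnat].
Qed.

(** * The power sums of the first integers *)

Lemma bernoulliE k : bernoulli k = k`!%:R * t_div_expm1 k.
Proof.
rewrite /bernoulli horner_bernoulli_poly; congr (_ * _).
rewrite /fps_mul big_ord_recl big1 => [|i _]; last by rewrite expr0n !mul0r.
by rewrite subn0 addr0 expr0 fact0 invr1 !mul1r.
Qed.

Lemma bernoulli_polyE k :
  bernoulli_poly k = \sum_(i < k.+1) ('C(k, i)%:R * bernoulli (k - i)) *: 'X^i.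
Proof.
rewrite /bernoulli_poly /fps_mul scaler_sumr; apply: eq_bigr => i _.
rewrite bernoulliE mulrC mul_polyC !scalerA; congr (_ *: _).
have ik : (i <= k)%N by rewrite -ltnS ltn_ord.
rewrite -(bin_fact ik) !natrM.
by have := fact_neq0 i => i0; field.
Qed.

(** S_{1,0}^n in expanded form, see [faulhaberE]: its values at the naturals are
    the sums 0^n + ... + (l-1)^n. *)
Definition faulhaber n : {poly rat} :=
  \sum_(i < n.+1) ('C(n, i)%:R * bernoulli (n - i) / i.+1%:R) *: 'X^(i.+1).

Lemma bernoulli_poly_faulhaber n :
  bernoulli_poly n.+1 = (bernoulli n.+1)%:P + n.+1%:R *: faulhaber n.
Proof.
rewrite bernoulli_polyE big_ord_recl bin0 mul1r subn0 expr0 alg_polyC.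
congr (_ + _); rewrite /faulhaber scaler_sumr; apply: eq_bigr => i _.
rewrite scalerA lift0 subSS; congr (_ *: _).
have := congr1 (fun k => k%:R : rat) (mul_bin_diag n.+1 i).
rewrite !natrM /= => E.
have i0 : (1 + i%:R : rat) != 0 by rewrite nat1r pnatr_eq0.
by apply: (mulfI i0); rewrite mulrA nat1r -E; field.
Qed.

Lemma power_sumE (m r : int) n (q := r%:~R / m%:~R : rat) :
  power_sum m r n =
  m%:~R ^+ n *: (faulhaber n \Po ('X + q%:P) - (faulhaber n).[q]%:P).
Proof.
rewrite /power_sum bernoulli_poly_faulhaber -/q.
rewrite comp_polyD comp_polyC comp_polyZ hornerD hornerC hornerZ.
rewrite polyCD polyCM opprD addrACA subrr add0r -mul_polyC -mulrBr mul_polyC scalerA.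
by rewrite divfK // pnatr_eq0.
Qed.

Lemma faulhaberE n : faulhaber n = power_sum 1 0 n.
Proof.
rewrite power_sumE expr1n scale1r mul0r addr0 comp_polyXr.
suff -> : (faulhaber n).[0] = 0 by rewrite subr0.
rewrite /faulhaber horner_sum big1 // => i _.
by rewrite hornerZ hornerXn expr0n mulr0.
Qed.

Lemma horner_faulhaber n l : (faulhaber n).[l%:R] = \sum_(i < l) i%:R ^+ n.
Proof.
rewrite faulhaberE horner_power_sum //.
by apply: eq_bigr => i _; rewrite mulr1 addr0.
Qed.

Lemma faulhaber_diff n x :
  (faulhaber n).[x + 1] - (faulhaber n).[x] = x ^+ n.
Proof.
have n0 : (n.+1%:R : rat) != 0 by rewrite pnatr_eq0.
apply: (mulfI n0); rewrite -bernoulli_poly_diff bernoulli_poly_faulhaber.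
by rewrite !hornerE; ring.
Qed.

Lemma coef_faulhaber n i : (i <= n)%N ->
  (faulhaber n)`_i.+1 = 'C(n, i)%:R * bernoulli (n - i) / i.+1%:R.
Proof.
move=> le_in; have li : (i < n.+1)%N by [].
rewrite /faulhaber coef_sum (bigD1 (Ordinal li)) //= coefZ coefXn eqxx mulr1.
rewrite big1 ?addr0 // => j /eqP jP.
rewrite coefZ coefXn eqSS [i == _]eq_sym; case: eqP => [ji|_]; last by rewrite mulr0.
by case: jP; apply: val_inj.
Qed.

(** The sum of the 0th powers of the naturals below 1 is B_0. *)
Lemma bernoulli0 : bernoulli 0 = 1.
Proof.
have := horner_faulhaber 0 1.
by rewrite /faulhaber !big_ord1 hornerZ hornerXn expr0 bin0 expr1 divr1 mul1r mulr1.
Qed.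

(** Indexed by the Bernoulli number that they involve, the coefficients share
    the denominator n+1 and carry the binomials that occur in f(n,j). *)
Lemma coef_faulhaber_bin n j : (j <= n)%N ->
  (faulhaber n)`_(n.+1 - j) = 'C(n.+1, j)%:R * bernoulli j / n.+1%:R.
Proof.
move=> le_jn; rewrite subSn // coef_faulhaber ?leq_subr // subKn //.
have := mul_bin_diag n.+1 (n - j).
rewrite -subSn // [in RHS]bin_sub ?leqW // => /(congr1 (fun k => k%:R : rat)).
rewrite !natrM /= subSn // => E.
have n0 : (n.+1%:R : rat) != 0 by rewrite pnatr_eq0.
have j0 : ((n - j).+1%:R : rat) != 0 by rewrite pnatr_eq0.
apply: (mulfI n0); apply: (mulfI j0).
transitivity (n.+1%:R * 'C(n, n - j)%:R * bernoulli j).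
  by move: n.+1%:R (n - j).+1%:R n0 j0 => a b a0 b0; field.
by rewrite E; move: n.+1%:R (n - j).+1%:R n0 j0 => a b a0 b0; field.
Qed.

Lemma poly_eq_nat (P Q : {poly rat}) :
  (forall l : nat, P.[l%:R] = Q.[l%:R]) -> P = Q.
Proof.
move=> PQ; apply/eqP; rewrite -subr_eq0; apply: contraT => D0.
pose rs := [seq i%:R : rat | i <- iota 0 (size (P - Q))].
have : (size rs < size (P - Q)%R)%N.
  apply: max_poly_roots => //; last first.
    by rewrite map_inj_uniq ?iota_uniq // => i j /eqP; rewrite eqr_nat => /eqP.
  by apply/allP=> _ /mapP[i _ ->]; rewrite rootE hornerD hornerN PQ subrr.
by rewrite size_map size_iota ltnn.
Qed.

(** The difference equation P(x+1) - P(x) = x^n runs backwards from P(0) = 0: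
    P(-l) = - ((-1)^n + ... + (-l)^n), which up to a sign is P(l+1). *)
Lemma faulhaber_reflect n : (0 < n)%N ->
  (-1) ^+ n.+1 *: (faulhaber n \Po - 'X) = faulhaber n + 'X^n.
Proof.
move=> n0; apply: poly_eq_nat => l.
rewrite hornerZ horner_comp hornerN hornerX hornerD hornerXn.
elim: l => [|l IH].
  rewrite oppr0 expr0n eqn0Ngt n0 addr0.
  by rewrite (horner_faulhaber n 0) big_ord0 mulr0.
have := faulhaber_diff n (- l.+1%:R); have := faulhaber_diff n l%:R.
rewrite natr1 -[l.+1%:R]natr1 opprD subrK => /eqP; rewrite subr_eq => /eqP ->.
move/eqP; rewrite subr_eq addrC -subr_eq => /eqP <-.
rewrite mulrBr IH -opprD [in X in _ - _ * X]exprNn mulrA -exprD addSn addnn.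
by rewrite exprS -signr_odd odd_double expr0; ring.
Qed.

(** B_n is the coefficient of X in [faulhaber n]. For odd n > 1 the reflection
    formula reads P(-X) = P(X) + X^n, and X^n has no term of degree 1, so that
    this coefficient is its own opposite. *)
Lemma bernoulli_odd n : odd n -> (1 < n)%N -> bernoulli n = 0.
Proof.
move=> odd_n n1; have n0 : (0 < n)%N by apply: ltnW.
have := congr1 (fun P : {poly rat} => P^`().[0]) (faulhaber_reflect n n0).
have d0 : (faulhaber n)^`().[0] = bernoulli n.
  by rewrite horner_coef0 coef_deriv coef_faulhaber // bin0 subn0 mul1r divr1.
rewrite derivZ deriv_comp derivN derivX derivD derivXn hornerZ hornerM horner_comp.
rewrite !hornerN hornerX oppr0 hornerD hornerMn hornerXn d0 hornerC.
rewrite -signr_odd /= odd_n expr0 expr0n.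
have -> : (n.-1 == 0%N) = false by lia.
rewrite mul0rn => ?; lra.
Qed.

(** * Integrality at a prime *)

(** By strong induction on n: the sum of the n-th powers of the naturals below p
    is an integer, and in its expansion p B_n + sum_(i > 0) every term with
    i > 0 is C(n,i) (p B_(n-i)) (p^i / (i+1)), which is integral at p. *)
Lemma bernoulli_loc_int p n : prime p -> p%:R * bernoulli n \in loc_int p^'.
Proof.
move=> p_pr; elim/ltn_ind: n => n IH.
have : (faulhaber n).[p%:R] \in loc_int p^'.
  by rewrite horner_faulhaber rpred_sum // => i _; rewrite rpredX ?rpred_nat.
rewrite /faulhaber horner_sum big_ord_recl hornerZ hornerXn /= expr1 divr1 bin0 mul1r.
rewrite subn0 mulrC rpredDr // rpred_sum // => i _.
rewrite hornerZ hornerXn.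
have := expr_div_loc_int p p i.+1 p_pr (dvdzz _).
have : p%:R * bernoulli (n - i.+1) \in loc_int p^' by apply: IH; have := ltn_ord i; lia.
move=> H1 H2; rewrite exprS -!mulrA.
have -> : bernoulli (n - i.+1) * (i.+2%:R^-1 * (p%:R * p%:R ^+ i.+1)) =
  (p%:R * bernoulli (n - i.+1)) * (p%:~R ^+ i.+1 / i.+2%:R) :> rat.
  by rewrite -pmulrn; ring.
by apply: rpredM; [apply: rpred_nat | apply: rpredM].
Qed.

Lemma expr_bernoulli_loc_int p (m : int) k : prime p -> (p%:Z %| m)%Z ->
  m%:~R ^+ k * bernoulli k \in loc_int p^'.
Proof.
move=> p_pr p_m; case: k => [|k]; first by rewrite bernoulli0 mulr1 rpred1.
have /dvdzP[c mE] := p_m; rewrite exprSr [in X in _ * X * _]mE intrM.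
rewrite -!mulrA; apply: rpredM; first by rewrite rpredX // rpred_int.
by apply: rpredM; [apply: rpred_int | apply: bernoulli_loc_int].
Qed.

(** The factor m^n is shared out as m^(n-i) m^i: the first part clears the
    denominator of B_(n-i), and the second one that of
    ((X + q)^(i+1) - q^(i+1)) / (i+1), whose coefficient of X^(j+1) becomes
    C(i,j) (m^j / (j+1)) r^(i-j). *)
Lemma power_sum_loc_int p (m r : int) n : prime p -> m != 0 ->
  (p%:Z %| m)%Z -> power_sum m r n \is a polyOver (loc_int p^').
Proof.
move=> p_pr m0 p_m; rewrite power_sumE; set q := _ / _.
have mq : (m%:~R : rat) != 0 by rewrite intr_eq0.
have mqE : m%:~R * q = r%:~R by rewrite mulrC divfK.
clearbody q.
rewrite /faulhaber horner_sum (raddf_sum (comp_poly _)) rmorph_sum -sumrB scaler_sumr.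
apply: rpred_sum => i _; set b := bernoulli _.
rewrite /= comp_polyZ comp_Xn_poly hornerZ hornerXn polyCM mul_polyC -scalerBr scalerA.
have iP : (i <= n)%N by rewrite -ltnS.
rewrite -{1}(subnK iP) exprD.
rewrite (_ : _ * _ = ('C(n, i)%:R * (m%:~R ^+ (n - i) * b)) * (m%:~R ^+ i / i.+1%:R));
  last by ring.
rewrite -scalerA; apply: polyOverZ.
  by apply: rpredM; [apply: rpred_nat | apply: expr_bernoulli_loc_int].
rewrite [_ + q%:P]addrC exprDn big_ord_recl bin0 mulr1n subn0 expr0 mulr1.
rewrite polyC_exp addrAC subrr add0r scaler_sumr; apply: rpred_sum => j _.
rewrite lift0 subSS -mulrnAl -polyC_exp -polyCMn mul_polyC scalerA.
apply: polyOverZ; last exact: polyOverXn.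
have jP : (j <= i)%N by rewrite -ltnS.
have E := congr1 (fun k => k%:R : rat) (mul_bin_diag i.+1 j).
rewrite !natrM /= in E.
have i0 : (i.+1%:R : rat) != 0 by rewrite pnatr_eq0.
have j0 : (j.+1%:R : rat) != 0 by rewrite pnatr_eq0.
rewrite (_ : m%:~R ^+ i / i.+1%:R * _ =
             'C(i, j)%:R * (m%:~R ^+ j / j.+1%:R) * r%:~R ^+ (i - j)).
  apply: rpredM; last by rewrite rpredX // rpred_int.
  by apply: rpredM; [apply: rpred_nat | apply: expr_div_loc_int].
have -> : m%:~R ^+ i = m%:~R ^+ j * m%:~R ^+ (i - j) :> rat by rewrite -exprD subnKC.
rewrite -mqE exprMn -mulr_natr.
apply: (mulfI i0); apply: (mulfI j0).
transitivity (m%:~R ^+ j * m%:~R ^+ (i - j) * q ^+ (i - j) *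
   (j.+1%:R * 'C(i.+1, j.+1)%:R)).
  by move: i.+1%:R i0 => a a0; field.
by rewrite -E; move: j.+1%:R j0 => a a0; field.
Qed.

Lemma loc_intVz pi (m : int) : pi.-nat `|m|%N -> (m%:~R^-1 : rat) \in loc_int pi.
Proof.
move=> /loc_intV; case: (intP m) => [|k|k]; rewrite ?absz0 ?absz_nat ?abszN //.
by rewrite mulrNz invrN rpredN.
Qed.

(** Over Z_(p) the substitution X -> X + q can be undone, and the constant lost
    when passing to S_{m,r}^n is recovered from P(0) = 0. *)
Lemma polyOver_power_sum_unit p (m r : int) n : prime p -> m != 0 ->
  ~~ (p%:Z %| m)%Z ->
  (power_sum m r n \is a polyOver (loc_int p^')) =
  (faulhaber n \is a polyOver (loc_int p^')).
Proof.
move=> p_pr m0 p_m; have mq : (m%:~R : rat) != 0 by rewrite intr_eq0.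
have mV : (m%:~R^-1 : rat) \in loc_int p^' by apply: loc_intVz; rewrite p'natE.
have mZ : (m%:~R : rat) \in loc_int p^' by rewrite rpred_int.
rewrite power_sumE; set q := _ / _.
have qZ : q \in loc_int p^' by apply: rpredM => //; apply: rpred_int.
clearbody q.
have XqP c : c \in loc_int p^' -> 'X + c%:P \is a polyOver (loc_int p^').
  by move=> cZ; rewrite rpredD ?polyOverX ?polyOverC.
apply/idP/idP => [|FP]; last first.
  apply: polyOverZ; first by rewrite rpredX.
  by rewrite rpredB ?polyOver_comp ?XqP // polyOverC rpred_horner.
(* [H] is P - P(q), obtained from the power sum by translating back. *)
set S := (_ *: _) => SP.
pose H := (m%:~R^-1 ^+ n *: S) \Po ('X + (- q)%:P).
have HP : H \is a polyOver (loc_int p^').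
  by rewrite polyOver_comp ?XqP ?rpredN // polyOverZ // rpredX.
have HE : H = faulhaber n - (faulhaber n).[q]%:P.
  rewrite /H /S scalerA -exprMn mulVf // expr1n scale1r.
  rewrite comp_polyB comp_polyC -comp_polyA comp_polyD comp_polyX comp_polyC.
  by rewrite -addrA -polyCD addNr addr0 comp_polyXr.
have H0 : H.[0] = - (faulhaber n).[q].
  by rewrite HE hornerD hornerN hornerC (horner_faulhaber n 0) big_ord0 add0r.
have -> : faulhaber n = H - H.[0]%:P by rewrite H0 HE polyCN opprK subrK.
by rewrite rpredB // polyOverC rpred_horner // rpred0.
Qed.

(** Only the coefficient with j = 1, namely C(n+1,1) B_1 / (n+1) = B_1, is not
    directly accounted for by the right-hand side. As the coefficients of P sum
    to P(1) = 0^n = 0, it is integral when all the others are; this covers p = 2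
    without computing the 2-adic valuation of any Bernoulli number. *)
Lemma polyOver_faulhaber p n : prime p -> (0 < n)%N ->
  faulhaber n \is a polyOver (loc_int p^') <->
  ~~ (p %| n.+1)%N /\
  (forall j, (2 <= j <= n)%N -> ~~ odd j ->
     'C(n.+1, j)%:R * bernoulli j \in loc_int p^').
Proof.
move=> p_pr n0; have nR0 : (n.+1%:R : rat) != 0 by rewrite pnatr_eq0.
split=> [/polyOverP FP|[p_n CB]].
  split=> [|j /andP[_ jn] _].
    have := FP (n.+1 - 0)%N; rewrite coef_faulhaber_bin // bin0 bernoulli0 mulr1 mul1r.
    by rewrite unfold_in -[n.+1%:R]/(n.+1%:~R) denqVz // p'natE.
  have := FP (n.+1 - j)%N; rewrite coef_faulhaber_bin //.
  move=> /rpredM/(_ (rpred_nat _ n.+1)).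
  by rewrite divfK.
(* With i = n - j, [c i] is the coefficient that involves B_j. *)
pose c i : rat := 'C(n, i)%:R * bernoulli (n - i) / i.+1%:R.
have cP i : (i <= n)%N -> (n - i != 1)%N -> c i \in loc_int p^'.
  move=> le_in ni1; rewrite /c -coef_faulhaber // -{1}(subKn le_in) -subSn ?leq_subr //.
  have := leq_subr i n; move: (n - i)%N ni1 => j j1 le_jn.
  rewrite coef_faulhaber_bin //; apply: rpredM; last by rewrite loc_intV ?p'natE.
  case: (leqP j 1) => [|j2].
    case: j j1 {le_jn} => [_ _|[]//]; by rewrite bin0 bernoulli0 mul1r rpred1.
  case: (boolP (odd j)) => [odd_j|]; first by rewrite bernoulli_odd // mulr0 rpred0.
  by apply: CB; rewrite j2.
have sum0 : \sum_(i < n.+1) c i = 0.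
  transitivity (faulhaber n).[1].
    rewrite /faulhaber horner_sum; apply: eq_bigr => i _.
    by rewrite hornerZ hornerXn expr1n mulr1.
  by rewrite (horner_faulhaber n 1) big_ord1 expr0n eqn0Ngt n0.
rewrite /faulhaber; apply: rpred_sum => i _; apply: polyOverZ; last exact: polyOverXn.
have le_in : (i <= n)%N by rewrite -ltnS.
have [ni1|] := eqVneq (n - i)%N 1%N; last exact: cP.
move: sum0; rewrite (bigD1 i) //= => /eqP; rewrite addr_eq0 => /eqP; rewrite {1}/c => ->.
rewrite rpredN rpred_sum // => k /eqP ki; have le_kn : (k <= n)%N by rewrite -ltnS.
by apply: cP => //; apply/eqP => nk1; apply: ki; apply: val_inj => /=; lia.
Qed.

(** * Divisibility by F(n) *)

Lemma dvdn_biglcm_seq (I : eqType) (s : seq I) (P : pred I) (G : I -> nat) M :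
  (\big[lcmn/1%N]_(i <- s | P i) G i %| M)%N = all (fun i => P i ==> (G i %| M)%N) s.
Proof.
elim: s => [|i s IH]; first by rewrite big_nil dvd1n.
by rewrite big_cons /=; case: (P i) => //=; rewrite dvdn_lcm IH.
Qed.

Lemma dvdn_prod_primes (s : seq nat) M : uniq s -> all prime s ->
  (\prod_(p <- s) p %| M)%N = all (fun p => p %| M)%N s.
Proof.
elim: s => [|p s IH] /=; first by rewrite big_nil dvd1n.
case/andP=> ps us /andP[p_pr pr_s]; rewrite big_cons Gauss_dvd ?IH //.
rewrite prime_coprime // Euclid_dvd_prod // big_has; apply: contra ps.
by case/hasP=> q q_s; rewrite dvdn_prime2 ?(allP pr_s q) // => /eqP ->.
Qed.

Lemma dvdn_div_gcd L N M : (0 < L)%N ->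
  (L %/ gcdn L N %| M)%N = (L %| M * N)%N.
Proof.
move=> L0; rewrite dvdn_divLR ?gcdn_gt0 ?L0 ?dvdn_gcdl //.
by rewrite muln_gcdr dvdn_gcd dvdn_mull.
Qed.

Lemma mul_bin_trinomial n k j : (j <= k <= n)%N ->
  ('C(n, k) * 'C(k, j) = 'C(n, j) * 'C(n - j, k - j))%N.
Proof.
case/andP=> jk kn; have jn := leq_trans jk kn.
apply/eqP; rewrite -(eqn_pmul2r (fact_gt0 (n - k))) -(eqn_pmul2r (fact_gt0 j)).
rewrite -(eqn_pmul2r (fact_gt0 (k - j))); apply/eqP.
have := bin_fact jk; have := bin_fact kn; have := bin_fact jn.
have := bin_fact (leq_sub2r j kn); rewrite subnBA // subnK //.
move: 'C(n - j, k - j) 'C(n, j) 'C(n, k) 'C(k, j) => x y z w E1 E2 E3 E4.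
transitivity n`!; first by rewrite -E3 -E4; ring.
by rewrite -E2 -E1; ring.
Qed.

(** As C(n+1,k) C(k,j) = C(n+1,j) C(n+1-j,k-j), the condition for k = j implies
    the conditions for all the other k. *)
Lemma dvdn_f n j M : (j <= n)%N ->
  (f n j %| M)%N = (M%:R * ('C(n.+1, j)%:R * bernoulli j) \is a Num.int).
Proof.
move=> le_jn; rewrite mulrA mulrC -natrM mulr_nat_int.
rewrite /f dvdn_biglcm_seq; apply/allP/idP => [/(_ j)|Lj k].
  rewrite mem_index_iota leqnn ltnS le_jn => /(_ isT) /=.
  by rewrite dvdn_div_gcd ?binn ?muln1 // absz_gt0 denq_neq0.
rewrite mem_index_iota ltnS => /andP[jk kn] /=.
rewrite dvdn_div_gcd ?absz_gt0 ?denq_neq0 // mul_bin_trinomial ?jk ?leqW // mulnA.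
exact: dvdn_mulr.
Qed.

Lemma dvdn_F n M :
  (F n %| M)%N <->
  (forall p, prime p -> (p %| n.+1)%N -> (p %| M)%N) /\
  (forall j, (2 <= j <= n)%N -> ~~ odd j ->
     M%:R * ('C(n.+1, j)%:R * bernoulli j) \is a Num.int).
Proof.
rewrite /F dvdn_lcm dvdn_biglcm_seq /rad.
rewrite dvdn_prod_primes ?primes_uniq ?all_prime_primes //.
split=> [/andP[/allP radM /allP fM]|[radM fM]].
  split=> [p p_pr p_n|j jn odd_j]; first by apply: radM; rewrite mem_primes p_pr.
  have := fM j; rewrite mem_index_iota ltnS => /(_ jn) /implyP/(_ odd_j).
  by rewrite dvdn_f //; case/andP: jn.
apply/andP; split; apply/allP.
  by move=> p; rewrite mem_primes => /and3P[p_pr _]; apply: radM.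
move=> j; rewrite mem_index_iota ltnS => jn; apply/implyP => odd_j.
by rewrite dvdn_f ?fM //; case/andP: jn.
Qed.

Theorem theorem2 (n : nat) (m r : int) (hn : (0 < n)%N) (hm : m != 0)
    (hmr : coprimez m r) :
  power_sum m r n \is a polyOver Num.int <-> ((F n)%:Z %| m)%Z.
Proof.
rewrite polyOver_int_localP dvdzE absz_nat dvdn_F.
split=> [SP|[radm fm] p p_pr].
  have FP p : prime p -> ~~ (p %| `|m|)%N -> faulhaber n \is a polyOver (loc_int p^').
    by move=> p_pr p_m; rewrite -(polyOver_power_sum_unit p m r) // SP.
  split=> [p p_pr p_n|j jn odd_j].
    apply: contraLR p_n => p_m.
    by have /polyOver_faulhaber[] := FP p p_pr p_m.
  apply/int_localP => p p_pr; have [p_m|p_m] := boolP (p %| `|m|)%N; last first.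
    apply: rpredM; first exact: rpred_nat.
    have /(polyOver_faulhaber p n p_pr hn)[_ CB] := FP p p_pr p_m; exact: CB.
  case/dvdnP: p_m => k ->; rewrite natrM mulrCA -mulrA.
  by apply: rpredM; [|apply: rpredM]; rewrite ?rpred_nat ?bernoulli_loc_int.
have [p_m|p_m] := boolP (p %| `|m|)%N; first exact: power_sum_loc_int.
rewrite polyOver_power_sum_unit //; apply/polyOver_faulhaber => //; split.
  by apply: contra p_m; apply: radm.
move=> j jn odd_j; have m0 : (`|m|%N%:R : rat) != 0 by rewrite pnatr_eq0 absz_eq0.
rewrite -[X in X \in _](mulKf m0); apply: rpredM; first by rewrite loc_intV // p'natE.
by apply: loc_int_int; apply: fm.
Qed.
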